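(* Let $G$ be a Polish group, let $X$ be a Polish space with a continuous action $G\curvearrowright X$, and suppose that the orbit equivalence relation $E^X_G$ is essentially countable. Then $E^X_G$ is $\sigma$-lacunary.
   Context: For a continuous action of a Polish group $G$ on a Polish space $X$, the orbit equivalence relation is $E^X_G=\{(x,y)\in X\times X:\exists g\in G\ g\cdot x=y\}$. For equivalence relations $E$ on $X$ and $F$ on $Y$ (Polish or standard Borel spaces), $E\le_B F$ means there is a Borel map $\psi:X\to Y$ with $(x,y)\in E\iff(\psi(x),\psi(y))\in F$ for all $x,y\in X$; $E\sim_B F$ means $E\le_B F$ and $F\le_B E$. An equivalence relation $F$ is countable if every $F$-class is countable. $E$ is essentially countable if $E\sim_B F$ for some countable Borel equivalence relation $F$ on a Polish space. $E^X_G$ is $\sigma$-lacunary if there are Borel sets $B_n\subseteq X$ and open neighbourhoods $V_n\subseteq G$ of $1_G$ ($n<\omega$) such that $\bigcup_n B_n$ is a countable complete section of $E^X_G$ (i.e. it meets every orbit, and meets each orbit in at most countably many points) and each $B_n$ is $V_n$-lacunary: whenever $g\cdot x=y$ with $g\in V_n$ and $x,y\in B_n$, then $x=y$. *)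

(* Defs.v *)
From Stdlib Require Import Reals.
Open Scope R_scope.

(* A topology is given by its family of open sets. *)
Definition topology (X : Type) := (X -> Prop) -> Prop.

Definition countable_set {X : Type} (S : X -> Prop) : Prop :=
  exists f : nat -> option X, forall x, S x -> exists n, f n = Some x.

Definition is_metric {X : Type} (d : X -> X -> R) : Prop :=
  (forall x y, 0 <= d x y) /\
  (forall x y, d x y = 0 <-> x = y) /\
  (forall x y, d x y = d y x) /\
  (forall x y z, d x z <= d x y + d y z).

Definition metric_compatible {X : Type} (o : topology X) (d : X -> X -> R) : Prop :=
  forall U, o U <-> (forall x, U x -> exists eps, 0 < eps /\ forall y, d x y < eps -> U y).

Definition metric_complete {X : Type} (d : X -> X -> R) : Prop :=
  forall u : nat -> X,
    (forall eps, 0 < eps -> exists N, forall m n, (N <= m)%nat -> (N <= n)%nat -> d (u m) (u n) < eps) ->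
    exists l, forall eps, 0 < eps -> exists N, forall n, (N <= n)%nat -> d (u n) l < eps.

Definition separable {X : Type} (o : topology X) : Prop :=
  exists D : X -> Prop, countable_set D /\
    forall U, o U -> (exists x, U x) -> exists x, U x /\ D x.

Definition polish {X : Type} (o : topology X) : Prop :=
  separable o /\ exists d, is_metric d /\ metric_complete d /\ metric_compatible o d.

Definition prod_top {X Y : Type} (oX : topology X) (oY : topology Y) : topology (X * Y) :=
  fun W => forall p, W p -> exists A B, oX A /\ oY B /\ A (fst p) /\ B (snd p) /\
      (forall q, A (fst q) -> B (snd q) -> W q).

Definition continuous {X Y : Type} (oX : topology X) (oY : topology Y) (f : X -> Y) : Prop :=
  forall U, oY U -> oX (fun x => U (f x)).

Inductive borel {X : Type} (o : topology X) : (X -> Prop) -> Prop :=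
| borel_open : forall U, o U -> borel o U
| borel_compl : forall A, borel o A -> borel o (fun x => ~ A x)
| borel_union : forall A : nat -> X -> Prop, (forall n, borel o (A n)) ->
    borel o (fun x => exists n, A n x)
| borel_ext : forall A B, borel o A -> (forall x, A x <-> B x) -> borel o B.

Definition borel_map {X Y : Type} (oX : topology X) (oY : topology Y) (f : X -> Y) : Prop :=
  forall B, borel oY B -> borel oX (fun x => B (f x)).

Definition borel_reducible {X Y : Type} (oX : topology X) (E : X -> X -> Prop)
    (oY : topology Y) (F : Y -> Y -> Prop) : Prop :=
  exists psi : X -> Y, borel_map oX oY psi /\
    forall x y, E x y <-> F (psi x) (psi y).

Definition equivalence_rel {X : Type} (E : X -> X -> Prop) : Prop :=
  (forall x, E x x) /\ (forall x y, E x y -> E y x) /\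
  (forall x y z, E x y -> E y z -> E x z).

Definition countable_borel_eqrel {Y : Type} (oY : topology Y) (F : Y -> Y -> Prop) : Prop :=
  equivalence_rel F /\
  borel (prod_top oY oY) (fun p => F (fst p) (snd p)) /\
  (forall y, countable_set (F y)).

Definition essentially_countable {X : Type} (oX : topology X) (E : X -> X -> Prop) : Prop :=
  exists (Y : Type) (oY : topology Y) (F : Y -> Y -> Prop),
    polish oY /\ countable_borel_eqrel oY F /\
    borel_reducible oX E oY F /\ borel_reducible oY F oX E.

Definition group_axioms {G : Type} (mul : G -> G -> G) (inv : G -> G) (one : G) : Prop :=
  (forall a b c, mul a (mul b c) = mul (mul a b) c) /\
  (forall a, mul one a = a) /\ (forall a, mul a one = a) /\
  (forall a, mul (inv a) a = one) /\ (forall a, mul a (inv a) = one).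

Definition polish_group {G : Type} (oG : topology G)
    (mul : G -> G -> G) (inv : G -> G) (one : G) : Prop :=
  group_axioms mul inv one /\ polish oG /\
  continuous (prod_top oG oG) oG (fun p => mul (fst p) (snd p)) /\
  continuous oG oG inv.

Definition continuous_action {G X : Type} (oG : topology G) (oX : topology X)
    (mul : G -> G -> G) (one : G) (act : G -> X -> X) : Prop :=
  (forall x, act one x = x) /\
  (forall g h x, act (mul g h) x = act g (act h x)) /\
  continuous (prod_top oG oX) oX (fun p => act (fst p) (snd p)).

Definition orbit_eqrel {G X : Type} (act : G -> X -> X) : X -> X -> Prop :=
  fun x y => exists g, act g x = y.

Definition lacunary {G X : Type} (act : G -> X -> X) (V : G -> Prop) (B : X -> Prop) : Prop :=
  forall g x y, V g -> B x -> B y -> act g x = y -> x = y.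

Definition countable_complete_section {X : Type} (E : X -> X -> Prop) (S : X -> Prop) : Prop :=
  (forall x, exists y, S y /\ E x y) /\
  (forall x, countable_set (fun y => S y /\ E x y)).

Definition sigma_lacunary {G X : Type} (oG : topology G) (oX : topology X)
    (one : G) (act : G -> X -> X) : Prop :=
  exists (B : nat -> X -> Prop) (V : nat -> G -> Prop),
    (forall n, borel oX (B n)) /\
    (forall n, oG (V n) /\ V n one) /\
    countable_complete_section (orbit_eqrel act) (fun x => exists n, B n x) /\
    (forall n, lacunary act (V n) (B n)).

(* Main.v *)
(** Let [psi] reduce the orbit relation to a countable equivalence relation on
    [Y], and let [U m] range over a countable base of [G].  By Baire category
    every [x] has, for some [m], a value [y] with [psi (g x) = y] for generic
    [g] in [U m].  If [u] and [u k] both lie in [U m], the generic values of [x]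
    and [k x] on [U m] agree.  Hence any Borel set on which the generic value on
    [U m] exists and is injective is lacunary for the set of all such [k], and
    meets each orbit in a countable set.

    It remains to choose, for each [y], one point among those with generic value
    [y] on [U m], in a Borel way.  Every Borel set has a sequence of countable
    Borel covers such that any consistent choice of members converges to a point
    of the set.  Choosing at each stage the first member whose translates are
    nonmeager gives a point that depends only on the orbit and on [y], since
    meagerness is invariant under right translation. *)

Require Import Defs.
From Stdlib Require Import Reals Lra Lia Compare_dec Cantor Classical ClassicalEpsilon.

(** * Choice, least witnesses and small reciprocals *)

Lemma functional_choice {A B : Type} (P : A -> B -> Prop) :
  (forall a, exists b, P a b) -> exists f : A -> B, forall a, P a (f a).
Proof.
  intro H.
  exists (fun a => proj1_sig (constructive_indefinite_description _ (H a))).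
  intro a. exact (proj2_sig (constructive_indefinite_description _ (H a))).
Qed.

Lemma least_witness (P : nat -> Prop) :
  (exists n, P n) -> exists n, P n /\ forall m, (m < n)%nat -> ~ P m.
Proof.
  intros [n Hn]. apply NNPP; intro Hno.
  assert (Hall : forall k m, (m < k)%nat -> ~ P m).
  { induction k as [|k IH]; intros m Hm HP; [lia|].
    apply Hno; exists m; split; [exact HP|].
    intros j Hj; apply IH; lia. }
  exact (Hall (S n) n (Nat.lt_succ_diag_r n) Hn).
Qed.

Lemma inv_INR_pos (n : nat) : 0 < / INR (S n).
Proof. apply Rinv_0_lt_compat, lt_0_INR; lia. Qed.

Lemma inv_INR_small (eps : R) : 0 < eps -> exists n, / INR (S n) < eps.
Proof.
  intro He. destruct (archimed_cor1 eps He) as [[|n] [Hn Hpos]]; [lia|].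
  exists n; exact Hn.
Qed.

(** * Abstract sigma-algebras *)

Record sigma_algebra {W : Type} (S : (W -> Prop) -> Prop) : Prop := {
  sa_full : S (fun _ => True);
  sa_compl : forall A, S A -> S (fun w => ~ A w);
  sa_union : forall A : nat -> W -> Prop, (forall n, S (A n)) -> S (fun w => exists n, A n w);
  sa_ext : forall A B, S A -> (forall w, A w <-> B w) -> S B }.

Section SigmaAlgebra.
Context {W : Type} {S : (W -> Prop) -> Prop} (HS : sigma_algebra S).

Lemma sa_const (P : Prop) : S (fun _ => P).
Proof.
  destruct (classic P) as [H|H].
  - apply (sa_ext _ HS _ _ (sa_full _ HS)); tauto.
  - apply (sa_ext _ HS _ _ (sa_compl _ HS _ (sa_full _ HS))); tauto.
Qed.

Lemma sa_inter (A : nat -> W -> Prop) :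
  (forall n, S (A n)) -> S (fun w => forall n, A n w).
Proof.
  intro H.
  apply (sa_ext _ HS (fun w => ~ exists n, ~ A n w)).
  - apply (sa_compl _ HS), (sa_union _ HS (fun n w => ~ A n w)).
    intro n; apply (sa_compl _ HS), H.
  - intro w; split.
    + intros Hw n; apply NNPP; intro Hn; apply Hw; exists n; exact Hn.
    + intros Hw [n Hn]; exact (Hn (Hw n)).
Qed.

Lemma sa_and (A B : W -> Prop) : S A -> S B -> S (fun w => A w /\ B w).
Proof.
  intros HA HB.
  apply (sa_ext _ HS (fun w => forall n : nat, match n with O => A w | _ => B w end)).
  - apply (sa_inter (fun n w => match n with O => A w | _ => B w end)).
    intros [|n]; assumption.
  - intro w; split.
    + intro H; exact (conj (H O) (H 1%nat)).
    + intros [H1 H2] [|n]; assumption.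
Qed.

Lemma sa_impl (P : Prop) (A : W -> Prop) : (P -> S A) -> S (fun w => P -> A w).
Proof.
  intro HA. destruct (classic P) as [H|H].
  - apply (sa_ext _ HS _ _ (HA H)); tauto.
  - apply (sa_ext _ HS _ _ (sa_full _ HS)); tauto.
Qed.

Lemma sa_union_length (n : nat) (A : list nat -> W -> Prop) :
  (forall l, S (A l)) -> S (fun w => exists l, length l = n /\ A l w).
Proof.
  revert A; induction n as [|n IH]; intros A HA.
  - apply (sa_ext _ HS _ _ (HA nil)). intro w; split.
    + intro H; exists nil; auto.
    + intros [[|i l] [Hl H]]; [exact H|discriminate].
  - apply (sa_ext _ HS (fun w => exists i, exists l, length l = n /\ A (cons i l) w)).
    + apply (sa_union _ HS (fun i w => exists l, length l = n /\ A (cons i l) w)).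
      intro i; apply IH; intro l; apply HA.
    + intro w; split.
      * intros [i [l [Hl H]]]; exists (cons i l); simpl; auto.
      * intros [[|i l] [Hl H]]; [discriminate|exists i, l; auto].
Qed.

(** Stratifying by length reduces the union over lists to iterated unions over [nat], so no coding
    of lists by numbers is required. *)
Lemma sa_union_list (A : list nat -> W -> Prop) :
  (forall l, S (A l)) -> S (fun w => exists l, A l w).
Proof.
  intro HA.
  apply (sa_ext _ HS (fun w => exists n, exists l, length l = n /\ A l w)).
  - apply (sa_union _ HS (fun n w => exists l, length l = n /\ A l w)).
    intro n; apply sa_union_length, HA.
  - intro w; split.
    + intros [n [l [_ H]]]; exists l; exact H.
    + intros [l H]; exists (length l), l; auto.
Qed.

(** Induction on Borel sets. [S] is arbitrary because the lemma is applied both to Borel sets and to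
    [vaught_measurable] sets. *)
Lemma sa_preimage {X : Type} (oX : topology X) (f : W -> X) :
  (forall O, oX O -> S (fun w => O (f w))) ->
  forall B, borel oX B -> S (fun w => B (f w)).
Proof.
  intros Hf B HB; induction HB as [U HU|A _ IH|A _ IH|A B _ IH Hext].
  - exact (Hf U HU).
  - exact (sa_compl _ HS _ IH).
  - exact (sa_union _ HS (fun n w => A n (f w)) IH).
  - apply (sa_ext _ HS _ _ IH); intro w; apply Hext.
Qed.

End SigmaAlgebra.

(** * Complete separable metrics; [e] takes optional values so that an empty space is allowed *)

Record polish_metric {X : Type} (o : topology X) (d : X -> X -> R) (e : nat -> option X) : Prop := {
  pm_metric : is_metric d;
  pm_complete : metric_complete d;
  pm_compat : metric_compatible o d;
  pm_dense : forall x eps, 0 < eps -> exists n c, e n = Some c /\ d c x < eps }.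

Lemma polish_has_metric {X : Type} (o : topology X) :
  polish o -> exists d e, polish_metric o d e.
Proof.
  intros [[D [[e He] HD]] [d [Hm [Hc Ho]]]].
  exists d, e; split; auto.
  intros x eps Heps.
  destruct Hm as [Hpos [Hz [Hsym Htri]]].
  destruct (HD (fun y => d x y < eps)) as [c [Hc1 Hc2]].
  - apply Ho; intros y Hy; exists (eps - d x y); split; [lra|].
    intros z Hzz; pose proof (Htri x y z); lra.
  - exists x; rewrite (proj2 (Hz x x) eq_refl); exact Heps.
  - destruct (He c Hc2) as [n Hn]; exists n, c; split; [exact Hn|].
    rewrite Hsym; exact Hc1.
Qed.

Section Metric.
Context {X : Type} {o : topology X} {d : X -> X -> R} {e : nat -> option X}
  (PM : polish_metric o d e).

Lemma dist_nonneg x y : 0 <= d x y.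
Proof. apply (pm_metric _ _ _ PM). Qed.

Lemma dist_refl x : d x x = 0.
Proof. apply (pm_metric _ _ _ PM); reflexivity. Qed.

Lemma dist_eq x y : d x y = 0 -> x = y.
Proof. apply (pm_metric _ _ _ PM). Qed.

Lemma dist_sym x y : d x y = d y x.
Proof. apply (pm_metric _ _ _ PM). Qed.

Lemma dist_tri x y z : d x z <= d x y + d y z.
Proof. apply (pm_metric _ _ _ PM). Qed.

Lemma dist_small_eq x y : (forall eps, 0 < eps -> d x y < eps) -> x = y.
Proof.
  intro H. apply dist_eq. pose proof (dist_nonneg x y) as Hn.
  destruct (Req_dec (d x y) 0) as [|Hne]; [assumption|].
  pose proof (H (d x y) ltac:(lra)); lra.
Qed.

Lemma open_of_ball U : (forall x, U x -> exists eps, 0 < eps /\ forall y, d x y < eps -> U y) -> o U.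
Proof. apply (pm_compat _ _ _ PM). Qed.

Lemma ball_of_open U x : o U -> U x -> exists eps, 0 < eps /\ forall y, d x y < eps -> U y.
Proof. intros HU; apply (pm_compat _ _ _ PM), HU. Qed.

Lemma open_full : o (fun _ => True).
Proof. apply open_of_ball; intros x _; exists 1; split; [lra|auto]. Qed.

Lemma open_inter U V : o U -> o V -> o (fun x => U x /\ V x).
Proof.
  intros HU HV; apply open_of_ball; intros x [Hu Hv].
  destruct (ball_of_open U x HU Hu) as [a [Ha HaU]].
  destruct (ball_of_open V x HV Hv) as [b [Hb HbV]].
  exists (Rmin a b); split; [apply Rmin_pos; assumption|].
  intros y Hy; pose proof (Rmin_l a b); pose proof (Rmin_r a b).
  split; [apply HaU|apply HbV]; lra.
Qed.

Lemma open_union {I : Type} (U : I -> X -> Prop) : (forall i, o (U i)) -> o (fun x => exists i, U i x).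
Proof.
  intros HU; apply open_of_ball; intros x [i Hi].
  destruct (ball_of_open _ x (HU i) Hi) as [a [Ha H]].
  exists a; split; [exact Ha|]; intros y Hy; exists i; auto.
Qed.

Lemma open_ext U V : o U -> (forall x, U x <-> V x) -> o V.
Proof.
  intros HU Hext; apply open_of_ball; intros x Hx.
  destruct (ball_of_open U x HU (proj2 (Hext x) Hx)) as [a [Ha H]].
  exists a; split; [exact Ha|]; intros y Hy; apply Hext; auto.
Qed.

Lemma open_ball c r : o (fun y => d c y < r).
Proof.
  apply open_of_ball; intros y Hy; exists (r - d c y); split; [lra|].
  intros z Hz; pose proof (dist_tri c y z); lra.
Qed.

Lemma borel_sigma : sigma_algebra (borel o).
Proof.
  split; [apply borel_open, open_full|apply borel_compl|apply borel_union|apply borel_ext].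
Qed.

Definition center_ball (r : R) (i : nat) (x : X) : Prop :=
  exists c, e i = Some c /\ d c x < r.

Lemma open_center_ball r i : o (center_ball r i).
Proof.
  apply open_of_ball; intros x [c [Hc Hx]].
  exists (r - d c x); split; [lra|].
  intros y Hy; exists c; split; [exact Hc|].
  pose proof (dist_tri c x y); lra.
Qed.

(** The base consists of balls of radius [/ INR (S k)] around the points of the dense sequence [e],
    with both indices coded in one number. *)
Lemma countable_base :
  exists U : nat -> X -> Prop, (forall n, o (U n)) /\
    forall O x, o O -> O x -> exists n, U n x /\ forall y, U n y -> O y.
Proof.
  exists (fun n => center_ball (/ INR (S (fst (of_nat n)))) (snd (of_nat n))).
  split; [intro n; apply open_center_ball|].
  intros O x HO Hx.
  destruct (ball_of_open O x HO Hx) as [eps [Heps HB]].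
  destruct (inv_INR_small (eps / 2)) as [k Hk]; [lra|].
  destruct (pm_dense _ _ _ PM x _ (inv_INR_pos k)) as [i [c [Hc Hd]]].
  exists (to_nat (k, i)); rewrite cancel_of_to; cbn [fst snd].
  split; [exists c; auto|].
  intros y [c' [Hc' Hy]]; rewrite Hc in Hc'; injection Hc' as <-.
  apply HB; pose proof (dist_tri x c y); rewrite (dist_sym x c) in *; lra.
Qed.

(** Empty members of a base are replaced by the whole space, which contains [x0]. Nonemptiness lets
    Baire category be applied to every member. *)
Lemma countable_nonempty_base (x0 : X) :
  exists U : nat -> X -> Prop, (forall n, o (U n)) /\ (forall n, exists x, U n x) /\
    forall O x, o O -> O x -> exists n, U n x /\ forall y, U n y -> O y.
Proof.
  destruct countable_base as [U [HU HB]].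
  exists (fun n x => U n x \/ ~ exists z, U n z); split; [|split].
  - intro n; destruct (classic (exists z, U n z)) as [H|H].
    + apply (open_ext _ _ (HU n)); intro x; tauto.
    + apply (open_ext _ _ open_full); intro x; tauto.
  - intro n; destruct (classic (exists z, U n z)) as [[z H]|H]; [exists z|exists x0]; auto.
  - intros O x HO Hx; destruct (HB O x HO Hx) as [n [Hn Hsub]]; exists n; split; [auto|].
    intros y [Hy|Hy]; [auto|]. exfalso; apply Hy; exists x; exact Hn.
Qed.

End Metric.

Arguments center_ball {X} d e r i x.

(** * Products of Polish metrics *)

Section ProductMetric.
Context {X Y : Type} {oX : topology X} {oY : topology Y}
  {dX : X -> X -> R} {dY : Y -> Y -> R} {eX : nat -> option X} {eY : nat -> option Y}
  (PX : polish_metric oX dX eX) (PY : polish_metric oY dY eY).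

Definition sum_dist (p q : X * Y) : R := dX (fst p) (fst q) + dY (snd p) (snd q).

Definition pair_seq (n : nat) : option (X * Y) :=
  match eX (fst (of_nat n)), eY (snd (of_nat n)) with
  | Some x, Some y => Some (x, y)
  | _, _ => None
  end.

Lemma polish_metric_prod : polish_metric (prod_top oX oY) sum_dist pair_seq.
Proof.
  split.
  - split; [|split; [|split]].
    + intros p q; unfold sum_dist.
      pose proof (dist_nonneg PX (fst p) (fst q)); pose proof (dist_nonneg PY (snd p) (snd q)); lra.
    + intros [x y] [x' y']; unfold sum_dist; simpl; split.
      * intro H; pose proof (dist_nonneg PX x x'); pose proof (dist_nonneg PY y y').
        f_equal; [apply (dist_eq PX)|apply (dist_eq PY)]; lra.
      * intro H; injection H as -> ->; rewrite (dist_refl PX), (dist_refl PY); lra.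
    + intros p q; unfold sum_dist; rewrite (dist_sym PX), (dist_sym PY); reflexivity.
    + intros p q r; unfold sum_dist.
      pose proof (dist_tri PX (fst p) (fst q) (fst r)).
      pose proof (dist_tri PY (snd p) (snd q) (snd r)); lra.
  - intros u Hu.
    destruct (pm_complete _ _ _ PX (fun n => fst (u n))) as [x Hx].
    { intros eps Heps; destruct (Hu eps Heps) as [N HN]; exists N; intros m n Hm Hn.
      pose proof (HN m n Hm Hn) as H; unfold sum_dist in H.
      pose proof (dist_nonneg PY (snd (u m)) (snd (u n))); lra. }
    destruct (pm_complete _ _ _ PY (fun n => snd (u n))) as [y Hy].
    { intros eps Heps; destruct (Hu eps Heps) as [N HN]; exists N; intros m n Hm Hn.
      pose proof (HN m n Hm Hn) as H; unfold sum_dist in H.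
      pose proof (dist_nonneg PX (fst (u m)) (fst (u n))); lra. }
    exists (x, y); intros eps Heps.
    destruct (Hx (eps / 2)) as [N1 H1]; [lra|].
    destruct (Hy (eps / 2)) as [N2 H2]; [lra|].
    exists (Nat.max N1 N2); intros n Hn; unfold sum_dist; simpl.
    pose proof (H1 n ltac:(lia)); pose proof (H2 n ltac:(lia)); lra.
  - intro W; split.
    + intros HW p Hp; destruct (HW p Hp) as [A [B [HA [HB [Ha [Hb Hsub]]]]]].
      destruct (ball_of_open PX A _ HA Ha) as [a [Ha0 HaA]].
      destruct (ball_of_open PY B _ HB Hb) as [b [Hb0 HbB]].
      exists (Rmin a b); split; [apply Rmin_pos; assumption|].
      intros q Hq; unfold sum_dist in Hq.
      pose proof (Rmin_l a b); pose proof (Rmin_r a b).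
      pose proof (dist_nonneg PX (fst p) (fst q)); pose proof (dist_nonneg PY (snd p) (snd q)).
      apply Hsub; [apply HaA|apply HbB]; lra.
    + intros HW p Hp; destruct (HW p Hp) as [eps [Heps HB]].
      exists (fun x => dX (fst p) x < eps / 2), (fun y => dY (snd p) y < eps / 2).
      split; [apply (open_ball PX)|split; [apply (open_ball PY)|]].
      split; [rewrite (dist_refl PX); lra|split; [rewrite (dist_refl PY); lra|]].
      intros q H1 H2; apply HB; unfold sum_dist; lra.
  - intros [x y] eps Heps.
    destruct (pm_dense _ _ _ PX x (eps / 2)) as [i [a [Ha Hda]]]; [lra|].
    destruct (pm_dense _ _ _ PY y (eps / 2)) as [j [b [Hb Hdb]]]; [lra|].
    exists (to_nat (i, j)), (a, b); unfold pair_seq; rewrite cancel_of_to; simpl.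
    rewrite Ha, Hb; split; [reflexivity|]; unfold sum_dist; simpl; lra.
Qed.

(** An open subset of the product is a countable union of basic rectangles, so measurability of the
    two coordinates suffices even when [S] does not come from a topology. *)
Lemma sa_preimage_pair {W : Type} {S : (W -> Prop) -> Prop} (HS : sigma_algebra S)
    (f : W -> X) (g : W -> Y) :
  (forall O, oX O -> S (fun w => O (f w))) ->
  (forall O, oY O -> S (fun w => O (g w))) ->
  forall C, borel (prod_top oX oY) C -> S (fun w => C (f w, g w)).
Proof.
  intros Hf Hg C HC.
  apply (sa_preimage HS (prod_top oX oY) (fun w => (f w, g w))); [|exact HC].
  clear C HC; intros O HO.
  destruct (countable_base PX) as [U [HU BU]].
  destruct (countable_base PY) as [V [HV BV]].
  apply (sa_ext _ HS (fun w => exists i, exists j,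
    (forall q, U i (fst q) -> V j (snd q) -> O q) /\ U i (f w) /\ V j (g w))).
  - apply (sa_union _ HS (fun i w => exists j, (forall q, U i (fst q) -> V j (snd q) -> O q) /\ U i (f w) /\ V j (g w))).
    intro i.
    apply (sa_union _ HS (fun j w => (forall q, U i (fst q) -> V j (snd q) -> O q) /\ U i (f w) /\ V j (g w))).
    intro j. apply (sa_and HS); [apply (sa_const HS)|].
    apply (sa_and HS); [apply Hf, HU|apply Hg, HV].
  - intro w; split.
    + intros [i [j [Hsub [H1 H2]]]]; apply Hsub; assumption.
    + intro H; destruct (HO _ H) as [A [B [HA [HB [Ha [Hb Hsub]]]]]].
      destruct (BU A _ HA Ha) as [i [Hi HiA]]; destruct (BV B _ HB Hb) as [j [Hj HjB]].
      exists i, j; split; [|auto].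
      intros q Hq1 Hq2; apply Hsub; auto.
Qed.

End ProductMetric.

(** * Complete sequences of covers *)

Section Sieves.
Context {X : Type} {o : topology X} {d : X -> X -> R} {e : nat -> option X}
  (PM : polish_metric o d e).

Definition cell (A : X -> Prop) (C : nat -> nat -> X -> Prop) (w : nat -> nat) (n : nat) (x : X) : Prop :=
  A x /\ forall j, (j < n)%nat -> C j (w j) x.

(* Only [A p] is required of the limit [p], not that [p] lie in the members of the covers. *)
Definition complete_covers (A : X -> Prop) (C : nat -> nat -> X -> Prop) : Prop :=
  (forall n i, borel o (C n i)) /\
  (forall n x, A x -> exists i, C n i x) /\
  (forall w, (forall n, exists x, cell A C w n x) ->
    exists p, A p /\ forall eps, 0 < eps -> exists n, forall x, cell A C w n x -> d p x < eps).

Definition sieved (A : X -> Prop) : Prop := exists C, complete_covers A C.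

Lemma sieved_ext A B : sieved A -> (forall x, A x <-> B x) -> sieved B.
Proof.
  intros [C [HC1 [HC2 HC3]]] Hext; exists C; split; [exact HC1|split].
  - intros n x Hx; apply HC2, Hext, Hx.
  - intros w Hw.
    assert (Hcell : forall n x, cell A C w n x <-> cell B C w n x).
    { intros n x; unfold cell; rewrite (Hext x); tauto. }
    destruct (HC3 w) as [p [Hp Hl]].
    + intro n; destruct (Hw n) as [x Hx]; exists x; apply Hcell, Hx.
    + exists p; split; [apply Hext, Hp|].
      intros eps Heps; destruct (Hl eps Heps) as [n Hn]; exists n.
      intros x Hx; apply Hn, Hcell, Hx.
Qed.

(** The first cover chooses a closed piece [D i], and the later ones are by balls of shrinking
    radius. Points of successive cells form a Cauchy sequence, whose limit stays in the chosen
    piece. *)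
Lemma sieved_Fsigma (A : X -> Prop) (D : nat -> X -> Prop) :
  (forall i, o (fun x => ~ D i x)) -> (forall x, A x <-> exists i, D i x) -> sieved A.
Proof.
  intros HD HA.
  exists (fun n i => match n with O => D i | S m => center_ball d e (/ INR (S m)) i end).
  split; [|split].
  - intros [|n] i.
    + apply (borel_ext o (fun x => ~ ~ D i x)); [apply borel_compl, borel_open, HD|].
      intro x; split; [apply NNPP|tauto].
    + apply borel_open, (open_center_ball PM).
  - intros [|n] x Hx; [apply HA, Hx|].
    destruct (pm_dense _ _ _ PM x _ (inv_INR_pos n)) as [i [c Hc]].
    exists i, c; exact Hc.
  - intros w Hw.
    destruct (functional_choice _ Hw) as [u Hu].
    (* Cover number [S n] uses radius [/ INR (S n)], and depth [S (S n)] is the first at which a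
       cell is constrained by it. *)
    assert (Hnear : forall n x y,
      cell A (fun n i => match n with O => D i | S m => center_ball d e (/ INR (S m)) i end) w (S (S n)) x ->
      cell A (fun n i => match n with O => D i | S m => center_ball d e (/ INR (S m)) i end) w (S (S n)) y ->
      d x y < 2 * / INR (S n)).
    { intros n x y [_ Hx] [_ Hy].
      destruct (Hx (S n) ltac:(lia)) as [c [Hc Hcx]].
      destruct (Hy (S n) ltac:(lia)) as [c' [Hc' Hcy]].
      rewrite Hc in Hc'; injection Hc' as <-.
      pose proof (dist_tri PM x c y); rewrite (dist_sym PM x c) in *; lra. }
    assert (Hu' : forall n m, (n <= m)%nat ->
      cell A (fun n i => match n with O => D i | S m => center_ball d e (/ INR (S m)) i end) w n (u m)).
    { intros n m Hnm; destruct (Hu m) as [H1 H2]; split; [exact H1|].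
      intros j Hj; apply H2; lia. }
    destruct (pm_complete _ _ _ PM u) as [p Hp].
    { intros eps Heps; destruct (inv_INR_small (eps / 2)) as [k Hk]; [lra|].
      exists (S (S k)); intros m n Hm Hn.
      pose proof (Hnear k (u m) (u n) (Hu' _ _ Hm) (Hu' _ _ Hn)); lra. }
    exists p; split.
    (* Otherwise a ball around [p] misses [D (w O)]. The index [S N] below is positive, so [u (S N)]
       obeys cover number [O] and lies in that piece. *)
    + apply HA; exists (w O); apply NNPP; intro Hno.
      destruct (ball_of_open PM _ p (HD (w O)) Hno) as [eps [Heps HB]].
      destruct (Hp eps Heps) as [N HN].
      apply (HB (u (S N))).
      * rewrite (dist_sym PM); apply HN; lia.
      * exact (proj2 (Hu (S N)) O ltac:(lia)).
    + intros eps Heps; destruct (inv_INR_small (eps / 4)) as [k Hk]; [lra|].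
      exists (S (S k)); intros x Hx.
      destruct (Hp (eps / 2)) as [N HN]; [lra|].
      pose proof (HN (Nat.max N (S (S k))) ltac:(lia)) as H1.
      pose proof (Hnear k _ _ (Hu' (S (S k)) (Nat.max N (S (S k))) ltac:(lia)) Hx).
      pose proof (dist_tri PM p (u (Nat.max N (S (S k)))) x).
      rewrite (dist_sym PM p (u _)) in *; lra.
Qed.

(** The covers of all the [A k] are interleaved by the pairing function. Each [k] yields a limit in
    [A k], and all these limits coincide because a deep enough cell contains a point close to any
    two of them. *)
Lemma sieved_inter (A : nat -> X -> Prop) :
  (forall k, sieved (A k)) -> sieved (fun x => forall k, A k x).
Proof.
  intro HA; destruct (functional_choice _ HA) as [C HC].
  pose (CC := fun n => C (fst (of_nat n)) (snd (of_nat n))).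
  exists CC; split; [|split].
  - intros n i; apply (HC (fst (of_nat n))).
  - intros n x Hx; apply (HC (fst (of_nat n))), Hx.
  - intros w Hw.
    assert (Hsub : forall k n, exists N, forall x, cell (fun x => forall k, A k x) CC w N x ->
       cell (A k) (C k) (fun n => w (to_nat (k, n))) n x).
    { intros k n.
      (* A depth past the codes of all pairs [(k, j)] with [j < n] imposes every constraint of the
         [k]-th system up to [n]. *)
      assert (Hb : exists N, forall j, (j < n)%nat -> (to_nat (k, j) < N)%nat).
      { induction n as [|n [N HN]]; [exists O; intros; lia|].
        exists (S (Nat.max N (to_nat (k, n)))); intros j Hj.
        destruct (Nat.eq_dec j n) as [->|Hne]; [lia|].
        pose proof (HN j ltac:(lia)); lia. }
      destruct Hb as [N HN]; exists N; intros x [Hx1 Hx2]; split; [apply Hx1|].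
      intros j Hj; specialize (Hx2 _ (HN j Hj)); unfold CC in Hx2.
      rewrite cancel_of_to in Hx2; exact Hx2. }
    assert (Hlim : forall k, exists p, A k p /\ forall eps, 0 < eps -> exists N, forall x,
       cell (fun x => forall k, A k x) CC w N x -> d p x < eps).
    { intro k; destruct (HC k) as [_ [_ H3]].
      destruct (H3 (fun n => w (to_nat (k, n)))) as [p [Hp Hl]].
      - intro n; destruct (Hsub k n) as [N HN]; destruct (Hw N) as [x Hx]; exists x; auto.
      - exists p; split; [exact Hp|]; intros eps Heps.
        destruct (Hl eps Heps) as [n Hn]; destruct (Hsub k n) as [N HN].
        exists N; intros x Hx; auto. }
    destruct (Hlim O) as [p [_ Hp]]; exists p; split; [|exact Hp].
    intro k; destruct (Hlim k) as [q [Hq Hlq]].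
    replace p with q; [exact Hq|].
    apply (dist_small_eq PM); intros eps Heps.
    destruct (Hp (eps / 2)) as [N1 H1]; [lra|].
    destruct (Hlq (eps / 2)) as [N2 H2]; [lra|].
    destruct (Hw (Nat.max N1 N2)) as [x [Hx1 Hx2]].
    pose proof (H1 x (conj Hx1 (fun j Hj => Hx2 j (Nat.lt_le_trans _ _ _ Hj (Nat.le_max_l _ _))))).
    pose proof (H2 x (conj Hx1 (fun j Hj => Hx2 j (Nat.lt_le_trans _ _ _ Hj (Nat.le_max_r _ _))))).
    pose proof (dist_tri PM q x p); rewrite (dist_sym PM x p) in *; lra.
Qed.

(** The first cover decides the piece, and the later ones merge the covers of all pieces. By
    disjointness, the index [k] hidden in a later cover must be the piece already chosen. *)
Lemma sieved_disjoint_union (A : nat -> X -> Prop) :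
  (forall k, borel o (A k)) -> (forall k, sieved (A k)) ->
  (forall j k x, A j x -> A k x -> j = k) -> sieved (fun x => exists k, A k x).
Proof.
  intros HB HA Hdisj; destruct (functional_choice _ HA) as [C HC].
  pose (CC := fun n i x => match n with O => A i x | S m => exists k, A k x /\ C k m i x end).
  exists CC; split; [|split].
  - intros [|n] i; [apply HB|].
    apply (borel_union o (fun k x => A k x /\ C k n i x)); intro k.
    apply (sa_and (borel_sigma PM)); [apply HB|apply (HC k)].
  - intros [|n] x [k Hk]; [exists k; exact Hk|].
    destruct (proj1 (proj2 (HC k)) n x Hk) as [i Hi]; exists i, k; auto.
  - intros w Hw.
    assert (Hsub : forall n x, cell (fun x => exists k, A k x) CC w (S n) x ->
       cell (A (w O)) (C (w O)) (fun n => w (S n)) n x).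
    { intros n x [_ Hx]; pose proof (Hx O ltac:(lia)) as H0; split; [exact H0|].
      intros j Hj; destruct (Hx (S j) ltac:(lia)) as [k [Hk1 Hk2]].
      rewrite (Hdisj _ _ _ H0 Hk1); exact Hk2. }
    destruct (proj2 (proj2 (HC (w O))) (fun n => w (S n))) as [p [Hp Hl]].
    + intro n; destruct (Hw (S n)) as [x Hx]; exists x; auto.
    + exists p; split; [exists (w O); exact Hp|].
      intros eps Heps; destruct (Hl eps Heps) as [n Hn].
      exists (S n); intros x Hx; auto.
Qed.

(** The induction carries complements along because a union is first made disjoint: each difference
    [A k] minus the earlier sets is an intersection of sieved sets only if complements are sieved
    too. *)
Lemma borel_sieved_both (A : X -> Prop) :
  borel o A -> sieved A /\ sieved (fun x => ~ A x).
Proof.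
  pose proof (borel_sigma PM) as HS.
  intro HA; induction HA as [U HU|A _ [IH1 IH2]|A HA IH|A B _ [IH1 IH2] Hext].
  - split.
    (* The closed pieces collect the points of [U] at distance at least [/ INR (S i)] from the
       complement. *)
    + apply (sieved_Fsigma U (fun i x => U x /\ forall y, ~ U y -> / INR (S i) <= d x y)).
      * intro i; apply (open_of_ball PM); intros x Hx.
        assert (Hy : exists y, ~ U y /\ d x y < / INR (S i)).
        { apply NNPP; intro Hno; apply Hx; split.
          - apply NNPP; intro Hx'; apply Hno; exists x; split; [exact Hx'|].
            rewrite (dist_refl PM); apply inv_INR_pos.
          - intros y Hy; apply Rnot_lt_le; intro Hlt; apply Hno; exists y; auto. }
        destruct Hy as [y [Hy Hlt]].
        exists (/ INR (S i) - d x y); split; [lra|].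
        intros z Hz [_ H]; specialize (H y Hy).
        pose proof (dist_tri PM z x y); rewrite (dist_sym PM z x) in *; lra.
      * intro x; split; [|intros [i [H _]]; exact H].
        intro Hx; destruct (ball_of_open PM U x HU Hx) as [eps [Heps HB]].
        destruct (inv_INR_small eps Heps) as [k Hk]; exists k; split; [exact Hx|].
        intros y Hy; apply Rnot_lt_le; intro Hlt; apply Hy, HB; lra.
    + apply (sieved_Fsigma _ (fun _ x => ~ U x)).
      * intros _; apply (open_ext PM U _ HU); intro x; split; [tauto|apply NNPP].
      * intro x; split; [intro H; exists O; exact H|intros [_ H]; exact H].
  - split; [exact IH2|].
    apply (sieved_ext _ _ IH1); intro x; split; [tauto|apply NNPP].
  - split.
    + pose (B := fun k x => A k x /\ forall j, (j < k)%nat -> ~ A j x).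
      apply (sieved_ext (fun x => exists k, B k x)).
      * apply sieved_disjoint_union.
        -- intro k; apply (sa_and HS); [apply HA|].
           apply (sa_inter HS (fun j x => (j < k)%nat -> ~ A j x)); intro j.
           apply (sa_impl HS); intros _; apply borel_compl, HA.
        -- intro k.
           (* The difference is padded to an intersection over all [j], with [A k] repeated from
              [j = k] on, to fit [sieved_inter]. *)
           apply (sieved_ext (fun x => forall j, if le_lt_dec k j then A k x else ~ A j x)).
           ++ apply (sieved_inter (fun j x => if le_lt_dec k j then A k x else ~ A j x)).
              intro j; destruct (le_lt_dec k j); apply IH.
           ++ intro x; split.
              ** intro H; split.
                 --- specialize (H k); destruct (le_lt_dec k k); [exact H|lia].
                 --- intros j Hj; specialize (H j); destruct (le_lt_dec k j); [lia|exact H].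
              ** intros [H1 H2] j; destruct (le_lt_dec k j); auto.
        -- intros j k x [Hj1 Hj2] [Hk1 Hk2].
           destruct (Nat.lt_trichotomy j k) as [H|[H|H]]; [|exact H|].
           ++ destruct (Hk2 j H Hj1).
           ++ destruct (Hj2 k H Hk1).
      * intro x; split; [intros [k [H _]]; exists k; exact H|].
        intro H; apply (least_witness (fun k => A k x) H).
    + apply (sieved_ext (fun x => forall k, ~ A k x)).
      * apply (sieved_inter (fun k x => ~ A k x)); intro k; apply IH.
      * intro x; split; [intros H [k Hk]; exact (H k Hk)|].
        intros H k Hk; apply H; exists k; exact Hk.
  - split.
    + apply (sieved_ext _ _ IH1 Hext).
    + apply (sieved_ext _ _ IH2); intro x; rewrite (Hext x); tauto.
Qed.

End Sieves.

(** * Large-section selection *)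

Section Selection.
Context {Z : Type} {o : topology Z} {d : Z -> Z -> R} {e : nat -> option Z}
  (PM : polish_metric o d e).
Context (Gam : Z -> Prop) (N : Z -> (Z -> Prop) -> Prop)
  (HGam : borel o Gam)
  (N_borel : forall Q, borel o Q -> borel o (fun z => N z Q))
  (N_mono : forall z (Q Q' : Z -> Prop), (forall x, Q x -> Q' x) -> N z Q -> N z Q')
  (N_union : forall z (Q : nat -> Z -> Prop), N z (fun x => exists i, Q i x) -> exists i, N z (Q i))
  (N_inhabited : forall z Q, N z Q -> exists x, Q x).

(** At each stage the least cover member that keeps the intersection [N z]-large is chosen;
    [N_union] supplies one, and completeness of the covers gives a limit in [Gam]. The choices
    depend only on which sets are [N z]-large, whence the second clause. The fixed points of [s]
    will serve as the section. *)
Lemma large_section_selection :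
  exists s : Z -> Z,
    (forall z, N z Gam -> Gam (s z) /\
       forall eps, 0 < eps -> N z (fun x => Gam x /\ d (s z) x < eps)) /\
    (forall z z', N z Gam -> (forall Q, N z Q <-> N z' Q) -> s z = s z') /\
    borel o (fun z => N z Gam /\ s z = z).
Proof.
  destruct (borel_sieved_both PM Gam HGam) as [[C [HC1 [HC2 HC3]]] _].
  pose proof (borel_sigma PM) as HS.
  (* Indices are stored with the latest at the head, so [length l'] is the stage at which [i] was
     chosen. *)
  set (cset := fix cset (l : list nat) : Z -> Prop :=
    match l with
    | nil => Gam
    | cons i l' => fun x => C (length l') i x /\ cset l' x
    end).
  (* [sel l z] holds exactly when [l] is the initial segment of the greedy least choices for [z]. *)
  set (sel := fix sel (l : list nat) (z : Z) : Prop :=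
    match l with
    | nil => N z Gam
    | cons i l' => sel l' z /\ N z (cset (cons i l')) /\
        forall j, (j < i)%nat -> ~ N z (cset (cons j l'))
    end).
  assert (Hcset : forall l, borel o (cset l)).
  { induction l as [|i l IH]; [exact HGam|].
    apply (sa_and HS); [apply HC1|exact IH]. }
  assert (Hsel : forall l, borel o (sel l)).
  { induction l as [|i l IH]; [apply N_borel, HGam|].
    apply (sa_and HS); [exact IH|].
    apply (sa_and HS); [apply N_borel, (Hcset (cons i l))|].
    apply (sa_inter HS (fun j z => (j < i)%nat -> ~ N z (cset (cons j l)))); intro j.
    apply (sa_impl HS); intros _; apply borel_compl, N_borel, (Hcset (cons j l)). }
  assert (cset_Gam : forall l x, cset l x -> Gam x).
  { induction l as [|i l IH]; intros x Hx; [exact Hx|apply IH, Hx]. }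
  assert (sel_N : forall l z, sel l z -> N z (cset l)).
  { intros [|i l] z H; [exact H|apply H]. }
  assert (sel_step : forall l z, sel l z -> exists i, sel (cons i l) z).
  { intros l z Hl.
    assert (Hex : exists i, N z (cset (cons i l))).
    { apply N_union, (N_mono z (cset l)); [|apply sel_N, Hl].
      intros x Hx; destruct (HC2 (length l) x (cset_Gam l x Hx)) as [i Hi].
      exists i; split; assumption. }
    destruct (least_witness _ Hex) as [i [Hi1 Hi2]].
    exists i; split; [exact Hl|split; assumption]. }
  assert (sel_unique : forall l l' z, length l = length l' -> sel l z -> sel l' z -> l = l').
  { induction l as [|i l IH]; intros [|i' l'] z Hlen Hl Hl'; try discriminate; [reflexivity|].
    destruct Hl as [Hl [Hi Hmin]]; destruct Hl' as [Hl' [Hi' Hmin']].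
    assert (l = l') as <- by (apply (IH l' z); auto).
    f_equal; destruct (Nat.lt_trichotomy i i') as [H|[H|H]]; [|exact H|].
    - destruct (Hmin' i H Hi).
    - destruct (Hmin i' H Hi'). }
  assert (sel_extend : forall l z, sel l z -> forall k, exists l',
    length l' = (k + length l)%nat /\ sel l' z /\ forall x, cset l' x -> cset l x).
  { intros l z Hl; induction k as [|k [l' [H1 [H2 H3]]]]; [exists l; auto|].
    destruct (sel_step l' z H2) as [i Hi]; exists (cons i l').
    split; [simpl; congruence|split; [exact Hi|]].
    intros x Hx; apply H3, Hx. }
  (* Here [z] enters only through [sel], which makes invariance under equal largeness immediate and
     leaves only countable quantifiers over lists. *)
  set (is_limit := fun z p => forall eps, 0 < eps -> exists n, forall l,
    (n <= length l)%nat -> sel l z -> forall x, cset l x -> d p x < eps).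
  assert (sel_limit : forall z, N z Gam -> exists p, Gam p /\ is_limit z p).
  { intros z Hz.
    assert (Hw : exists pre : nat -> list nat, forall n, length (pre n) = n /\ sel (pre n) z).
    { apply (functional_choice (fun n l => length l = n /\ sel l z)).
      intro n; destruct (sel_extend nil z Hz n) as [l [H1 [H2 _]]]; exists l.
      split; [rewrite H1; simpl; lia|exact H2]. }
    destruct Hw as [pre Hpre].
    (* By [sel_unique] the selected lists of different lengths extend one another, so they trace a
       single branch [w]. *)
    assert (Hw : exists w : nat -> nat, forall n, pre (S n) = cons (w n) (pre n)).
    { apply (functional_choice (fun n i => pre (S n) = cons i (pre n))); intro n.
      destruct (Hpre (S n)) as [H1 H2]; destruct (Hpre n) as [H3 H4].
      destruct (pre (S n)) as [|i l]; [discriminate|]; exists i; f_equal.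
      apply (sel_unique _ _ z); [simpl in H1; congruence|apply H2|exact H4]. }
    destruct Hw as [w Hw].
    assert (Hcell : forall n x, cset (pre n) x <-> cell Gam C w n x).
    { intros n x; induction n as [|n IH].
      - destruct (Hpre O) as [H0 _]; destruct (pre O); [|discriminate].
        split; [intro H; split; [exact H|intros; lia]|intros [H _]; exact H].
      - rewrite Hw; simpl; rewrite (proj1 (Hpre n)), IH; split.
        + intros [H1 [H2 H3]]; split; [exact H2|]; intros j Hj.
          destruct (Nat.eq_dec j n) as [->|Hne]; [exact H1|apply H3; lia].
        + intros [H2 H3]; split; [apply H3; lia|split; [exact H2|intros j Hj; apply H3; lia]]. }
    destruct (HC3 w) as [p [Hp Hl]].
    { intro n; destruct (N_inhabited z _ (sel_N _ _ (proj2 (Hpre n)))) as [x Hx].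
      exists x; apply Hcell, Hx. }
    exists p; split; [exact Hp|]; intros eps Heps.
    destruct (Hl eps Heps) as [n Hn]; exists n; intros l Hlen Hsell x Hx.
    apply Hn; split; [apply (cset_Gam l), Hx|]; intros j Hj.
    assert (l = pre (length l)) as Hpl.
    { apply (sel_unique _ _ z); [symmetry|exact Hsell|]; apply Hpre. }
    rewrite Hpl in Hx; apply Hcell in Hx; apply Hx; lia. }
  assert (limit_near : forall z p eps, 0 < eps -> is_limit z p -> forall l, sel l z ->
    exists x, cset l x /\ d p x < eps).
  { intros z p eps Heps Hp l Hl; destruct (Hp eps Heps) as [n Hn].
    destruct (sel_extend l z Hl n) as [l' [H1 [H2 H3]]].
    destruct (N_inhabited z _ (sel_N _ _ H2)) as [x Hx].
    exists x; split; [apply H3, Hx|]; apply (Hn l'); [lia|exact H2|exact Hx]. }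
  assert (limit_unique : forall z p q, N z Gam -> is_limit z p -> is_limit z q -> p = q).
  { intros z p q Hz Hp Hq; apply (dist_small_eq PM); intros eps Heps.
    destruct (Hp (eps / 2)) as [n Hn]; [lra|].
    destruct (sel_extend nil z Hz n) as [l [H1 [H2 _]]].
    destruct (limit_near z q (eps / 2) ltac:(lra) Hq l H2) as [x [Hx Hqx]].
    pose proof (Hn l ltac:(lia) H2 x Hx); pose proof (dist_tri PM p x q).
    rewrite (dist_sym PM q x) in *; lra. }
  (* Where [Gam] is not [N z]-large the point [z] itself serves as a default; every clause to be
     proved is restricted to the other case. *)
  assert (Hs : forall z, exists p, N z Gam -> Gam p /\ is_limit z p).
  { intro z; destruct (classic (N z Gam)) as [Hz|Hz].
    - destruct (sel_limit z Hz) as [p Hp]; exists p; intros _; exact Hp.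
    - exists z; tauto. }
  destruct (functional_choice _ Hs) as [s Hs']; clear Hs; exists s.
  split; [|split].
  - intros z Hz; destruct (Hs' z Hz) as [H1 H2]; split; [exact H1|].
    intros eps Heps; destruct (H2 eps Heps) as [n Hn].
    destruct (sel_extend nil z Hz n) as [l [Hl1 [Hl2 _]]].
    apply (N_mono z (cset l)); [|apply sel_N, Hl2].
    intros x Hx; split; [apply (cset_Gam l), Hx|apply (Hn l); auto; lia].
  - intros z z' Hz Heq.
    assert (Hz' : N z' Gam) by (apply Heq, Hz).
    assert (Hsel' : forall l, sel l z <-> sel l z').
    { induction l as [|i l IH]; [apply Heq|].
      simpl; split; intros [H1 [H2 H3]]; (split; [apply IH, H1|split; [apply Heq, H2|]]);
        intros j Hj HN; apply (H3 j Hj), Heq, HN. }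
    apply (limit_unique z); [exact Hz|apply Hs', Hz|].
    intros eps Heps; destruct (proj2 (Hs' z' Hz') eps Heps) as [n Hn].
    exists n; intros l Hlen Hl; apply Hn; [exact Hlen|apply Hsel', Hl].
  (* Being the limit is expressed by countably many conditions: for each [m] some selected set lies
     in the closed ball of radius [/ INR (S m)] around [z]. *)
  - apply (borel_ext o (fun z => (N z Gam /\ Gam z) /\ forall m, exists l, sel l z /\
      forall x, cset l x -> d z x <= / INR (S m))).
    + apply (sa_and HS); [apply (sa_and HS); [apply N_borel|]; exact HGam|].
      apply (sa_inter HS (fun m z => exists l, sel l z /\ forall x, cset l x -> d z x <= / INR (S m))).
      intro m; apply (sa_union_list HS (fun l z => sel l z /\ forall x, cset l x -> d z x <= / INR (S m))).
      intro l; apply (sa_and HS); [apply Hsel|].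
      (* For a fixed list [l] this is a closed condition on [z], since a point of [cset l] too far
         from [z] remains so for nearby [z]. *)
      apply (borel_ext o (fun z => ~ exists x, cset l x /\ / INR (S m) < d z x)).
      * apply borel_compl, borel_open, (open_of_ball PM); intros z [x [Hx Hlt]].
        exists (d z x - / INR (S m)); split; [lra|]; intros y Hy; exists x; split; [exact Hx|].
        pose proof (dist_tri PM z y x); lra.
      * intro z; split.
        -- intros H x Hx; apply Rnot_lt_le; intro Hlt; apply H; exists x; auto.
        -- intros H [x [Hx Hlt]]; pose proof (H x Hx); lra.
    + intro z; split.
      * intros [[Hz _] H]; split; [exact Hz|].
        apply (dist_small_eq PM); intros eps Heps.
        destruct (inv_INR_small (eps / 2)) as [m Hm]; [lra|].
        destruct (H m) as [l [Hl Hlx]].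
        destruct (limit_near z (s z) (eps / 2) ltac:(lra) (proj2 (Hs' z Hz)) l Hl) as [x [Hx Hsx]].
        pose proof (Hlx x Hx); pose proof (dist_tri PM (s z) x z).
        rewrite (dist_sym PM x z) in *; lra.
      * intros [Hz Heq]; destruct (Hs' z Hz) as [H1 H2]; rewrite Heq in H1, H2.
        split; [split; assumption|]; intro m.
        destruct (H2 _ (inv_INR_pos m)) as [n Hn].
        destruct (sel_extend nil z Hz n) as [l [Hl1 [Hl2 _]]].
        exists l; split; [exact Hl2|]; intros x Hx; apply Rlt_le, (Hn l); auto; lia.
Qed.
End Selection.

(** * Baire category *)

Definition nowhere_dense {X : Type} (o : topology X) (N : X -> Prop) : Prop :=
  forall O, o O -> (exists x, O x) ->
  exists O', o O' /\ (exists x, O' x) /\ (forall x, O' x -> O x) /\ forall x, O' x -> ~ N x.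

Definition meager {X : Type} (o : topology X) (M : X -> Prop) : Prop :=
  exists N : nat -> X -> Prop, (forall n, nowhere_dense o (N n)) /\ forall x, M x -> exists n, N n x.

Section Meager.
Context {X : Type} (o : topology X).

Lemma meager_subset (M M' : X -> Prop) :
  meager o M -> (forall x, M' x -> M x) -> meager o M'.
Proof. intros [N [H1 H2]] Hsub; exists N; split; auto. Qed.

Lemma meager_nowhere_dense (M : X -> Prop) : nowhere_dense o M -> meager o M.
Proof. intro H; exists (fun _ => M); split; [auto|intros x Hx; exists O; exact Hx]. Qed.

Lemma meager_empty (M : X -> Prop) : (forall x, ~ M x) -> meager o M.
Proof.
  intro H; apply meager_nowhere_dense; intros O HO Hne; exists O; auto.
Qed.

Lemma meager_union (M : nat -> X -> Prop) :
  (forall n, meager o (M n)) -> meager o (fun x => exists n, M n x).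
Proof.
  intro H; destruct (functional_choice _ H) as [N HN].
  exists (fun k => N (fst (of_nat k)) (snd (of_nat k))); split.
  - intro k; apply (HN (fst (of_nat k))).
  - intros x [n Hn]; destruct (proj2 (HN n) x Hn) as [m Hm].
    exists (to_nat (n, m)); rewrite cancel_of_to; exact Hm.
Qed.

Lemma meager_or (M M' : X -> Prop) : meager o M -> meager o M' -> meager o (fun x => M x \/ M' x).
Proof.
  intros H H'.
  apply (meager_subset (fun x => exists n, match n with O => M x | S _ => M' x end)).
  - apply (meager_union (fun n x => match n with O => M x | S _ => M' x end)).
    intros [|n]; assumption.
  - intros x [Hx|Hx]; [exists O|exists 1%nat]; exact Hx.
Qed.

(** A homeomorphism preserves nowhere density: carry the open set over, shrink it there and pull the
    result back. *)
Lemma meager_preimage (f f' : X -> X) (M : X -> Prop) :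
  continuous o o f -> continuous o o f' ->
  (forall x, f (f' x) = x) -> (forall x, f' (f x) = x) ->
  meager o M -> meager o (fun x => M (f x)).
Proof.
  intros Hf Hf' H1 H2 [N [HN HM]].
  exists (fun n x => N n (f x)); split; [|intros x; apply HM].
  intros n O HO [x Hx].
  destruct (HN n (fun y => O (f' y))) as [O' [HO' [[y Hy] [Hsub Hdis]]]].
  - exact (Hf' O HO).
  - exists (f x); rewrite H2; exact Hx.
  - exists (fun x => O' (f x)); split; [exact (Hf O' HO')|split; [|split]].
    + exists (f' y); rewrite H1; exact Hy.
    + intros z Hz; rewrite <- (H2 z); apply Hsub, Hz.
    + intros z Hz; apply Hdis, Hz.
Qed.

(** The usual nested closed balls: the [n]-th step avoids [N n] and makes the radius at most
    [/ INR (S n)], so the centers converge to a point of [V] outside every [N n]. *)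
Lemma baire {d : X -> X -> R} {e : nat -> option X} (PM : polish_metric o d e) (V : X -> Prop) :
  o V -> (exists x, V x) -> ~ meager o V.
Proof.
  intros HV [x0 Hx0] [N [HN HM]].
  assert (Hball : forall O x, o O -> O x -> exists r, 0 < r /\ forall y, d x y <= r -> O y).
  { intros O x HO Hx; destruct (ball_of_open PM O x HO Hx) as [r [Hr H]].
    exists (r / 2); split; [lra|]; intros y Hy; apply H; lra. }
  (* Balls carry the proof that their radius is positive, so that the choice function can be
     iterated. *)
  pose (B := {b : X * R | 0 < snd b}).
  assert (Hstep : forall nb : nat * B, exists b' : B,
    snd (proj1_sig b') <= / INR (S (fst nb)) /\
    forall y, d (fst (proj1_sig b')) y <= snd (proj1_sig b') ->
      d (fst (proj1_sig (snd nb))) y <= snd (proj1_sig (snd nb)) /\ ~ N (fst nb) y).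
  { intros [n [[c r] Hr]]; simpl in *.
    destruct (HN n (fun y => d c y < r)) as [O' [HO' [[x Hx] [Hsub Hdis]]]].
    - apply (open_ball PM).
    - exists c; rewrite (dist_refl PM); exact Hr.
    - destruct (Hball O' x HO' Hx) as [r' [Hr' H]].
      assert (Hmin : 0 < snd (x, Rmin r' (/ INR (S n)))) by (apply Rmin_pos; [exact Hr'|apply inv_INR_pos]).
      exists (exist (fun b : X * R => 0 < snd b) (x, Rmin r' (/ INR (S n))) Hmin); cbn [proj1_sig fst snd]; split; [apply Rmin_r|].
      intros y Hy; pose proof (Rmin_l r' (/ INR (S n))).
      assert (Hy' : O' y) by (apply H; lra).
      split; [apply Rlt_le, Hsub, Hy'|apply Hdis, Hy']. }
  destruct (functional_choice _ Hstep) as [next Hnext]; clear Hstep.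
  destruct (Hball V x0 HV Hx0) as [r0 [Hr0 Hin]].
  pose (b := fix b (n : nat) : B := match n with O => exist (fun b : X * R => 0 < snd b) (x0, r0) Hr0 | S m => next (m, b m) end).
  pose (c := fun n => fst (proj1_sig (b n))); pose (r := fun n => snd (proj1_sig (b n))).
  assert (Hrpos : forall n, 0 < r n) by (intro n; exact (proj2_sig (b n))).
  assert (Hb : forall n, r (S n) <= / INR (S n) /\
    forall y, d (c (S n)) y <= r (S n) -> d (c n) y <= r n /\ ~ N n y).
  { intro n; exact (Hnext (n, b n)). }
  assert (Hnest : forall n m, (n <= m)%nat -> forall y, d (c m) y <= r m -> d (c n) y <= r n).
  { intros n m Hnm; induction Hnm as [|m Hnm IH]; intros y Hy; [exact Hy|].
    apply IH, Hb, Hy. }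
  assert (Hc : forall n m, (n <= m)%nat -> d (c n) (c m) <= r n).
  { intros n m Hnm; apply (Hnest n m Hnm); rewrite (dist_refl PM); apply Rlt_le, Hrpos. }
  destruct (pm_complete _ _ _ PM c) as [l Hl].
  { intros eps Heps; destruct (inv_INR_small (eps / 2)) as [k Hk]; [lra|].
    exists (S k); intros m n Hm Hn.
    pose proof (Hc _ _ Hm); pose proof (Hc _ _ Hn); pose proof (proj1 (Hb k)).
    pose proof (dist_tri PM (c m) (c (S k)) (c n)); rewrite (dist_sym PM (c m) (c (S k))) in *; lra. }
  (* Closed balls are used so that the limit of the centers stays in every ball. *)
  assert (Hlim : forall n, d (c n) l <= r n).
  { intro n; apply Rnot_lt_le; intro Hlt.
    destruct (Hl (d (c n) l - r n)) as [K HK]; [lra|].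
    pose proof (HK (Nat.max K n) ltac:(lia)); pose proof (Hc n (Nat.max K n) ltac:(lia)).
    pose proof (dist_tri PM (c n) (c (Nat.max K n)) l); lra. }
  destruct (HM l (Hin l (Hlim O))) as [n Hn].
  exact (proj2 (proj2 (Hb n) l (Hlim (S n))) Hn).
Qed.

End Meager.

(** * Vaught transforms *)

Section Vaught.
Context {G : Type} {oG : topology G} {d : G -> G -> R} {e : nat -> option G}
  (PG : polish_metric oG d e).
Context (U : nat -> G -> Prop) (U_open : forall n, oG (U n)) (U_inh : forall n, exists x, U n x)
  (U_base : forall O x, oG O -> O x -> exists n, U n x /\ forall y, U n y -> O y).

(* Equivalent to the Baire property. *)
Definition tame (A : G -> Prop) : Prop :=
  forall V, oG V -> meager oG (fun g => V g /\ A g) \/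
    exists n, (forall g, U n g -> V g) /\ meager oG (fun g => U n g /\ ~ A g).

(** Turns comeagerness in [V] into countably many nonmeagerness conditions. Forward, Baire category
    applies to each [U n]; backward, the basic sets on which [A] is comeager are dense in [V]. *)
Lemma tame_comeager (A V : G -> Prop) : tame A -> oG V ->
  (meager oG (fun g => V g /\ ~ A g) <->
   forall n, (forall g, U n g -> V g) -> ~ meager oG (fun g => U n g /\ A g)).
Proof.
  intros HA HV; split.
  - intros HM n Hsub HM'; apply (baire oG PG (U n) (U_open n) (U_inh n)).
    apply (meager_subset oG _ _ (meager_or oG _ _ HM HM')).
    intros g Hg; destruct (classic (A g)); auto.
  - intro H.
    pose (J := fun n => (forall g, U n g -> V g) /\ meager oG (fun g => U n g /\ ~ A g)).
    apply (meager_subset oG (fun g => (exists n, J n /\ U n g /\ ~ A g) \/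
      (V g /\ ~ exists n, J n /\ U n g))).
    + apply meager_or.
      * apply (meager_union oG (fun n g => J n /\ U n g /\ ~ A g)); intro n.
        destruct (classic (J n)) as [HJ|HJ].
        -- apply (meager_subset oG _ _ (proj2 HJ)); tauto.
        -- apply meager_empty; tauto.
      (* What remains of [V] outside the basic sets in [J] is nowhere dense: inside any open set
         that meets [V], tameness on a basic subset produces a member of [J]. *)
      * apply meager_nowhere_dense; intros O HO [x Hx].
        destruct (classic (exists y, O y /\ V y)) as [[y [Hy1 Hy2]]|Hno].
        -- destruct (U_base (fun g => O g /\ V g) y (open_inter PG O V HO HV) (conj Hy1 Hy2))
             as [n [Hn Hsub]].
           destruct (HA (U n) (U_open n)) as [HM|[k [Hk1 Hk2]]].
           ++ destruct (H n); [intros g Hg; apply Hsub, Hg|exact HM].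
           ++ exists (U k); split; [apply U_open|split; [apply U_inh|split]].
              ** intros g Hg; apply Hsub, Hk1, Hg.
              ** intros g Hg [_ Hg']; apply Hg'; exists k; split; [|exact Hg].
                 split; [intros h Hh; apply Hsub, Hk1, Hh|exact Hk2].
        -- exists O; split; [exact HO|split; [exists x; exact Hx|split; [auto|]]].
           intros g Hg [Hg' _]; apply Hno; exists g; auto.
    + intros g [Hg1 Hg2]; destruct (classic (exists n, J n /\ U n g)) as [[n [Hn1 Hn2]]|Hno].
      * left; exists n; auto.
      * right; auto.
Qed.

(** If the criterion of [tame_comeager] fails, the [n] at which it fails is a basic set on which the
    complement is comeager. *)
Lemma tame_compl (A : G -> Prop) : tame A -> tame (fun g => ~ A g).
Proof.
  intros HA V HV.
  destruct (classic (meager oG (fun g => V g /\ ~ A g))) as [H|H]; [left; exact H|right].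
  rewrite (tame_comeager A V HA HV) in H; apply NNPP; intro Hno; apply H.
  intros n Hn HM; apply Hno; exists n; split; [exact Hn|].
  apply (meager_subset oG _ _ HM); intros g [Hg1 Hg2]; split; [exact Hg1|apply NNPP, Hg2].
Qed.

Lemma tame_union (A : nat -> G -> Prop) : (forall n, tame (A n)) -> tame (fun g => exists n, A n g).
Proof.
  intros HA V HV.
  destruct (classic (forall n, meager oG (fun g => V g /\ A n g))) as [H|H].
  - left; apply (meager_subset oG _ _ (meager_union oG _ H)).
    intros g [Hg [n Hn]]; exists n; auto.
  - right; apply not_all_ex_not in H; destruct H as [n Hn].
    destruct (HA n V HV) as [HM|[k [Hk1 Hk2]]]; [contradiction|].
    exists k; split; [exact Hk1|].
    apply (meager_subset oG _ _ Hk2); intros g [Hg1 Hg2]; split; [exact Hg1|].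
    intro H; apply Hg2; exists n; exact H.
Qed.

Lemma tame_open (A : G -> Prop) : oG A -> tame A.
Proof.
  intros HA V HV.
  destruct (classic (exists g, V g /\ A g)) as [[g Hg]|H].
  - right; destruct (U_base _ g (open_inter PG V A HV HA) Hg) as [n [_ Hn]].
    exists n; split; [intros h Hh; apply Hn, Hh|].
    apply meager_empty; intros h [Hh1 Hh2]; apply Hh2, Hn, Hh1.
  - left; apply meager_empty; intros g Hg; apply H; exists g; exact Hg.
Qed.

Context {Z : Type} {oZ : topology Z} {dZ : Z -> Z -> R} {eZ : nat -> option Z}
  (PZ : polish_metric oZ dZ eZ).

(** The second clause says that Vaught transforms are Borel. Tameness of the sections is included
    because closure under complement relies on [tame_comeager]. *)
Definition vaught_measurable (A : Z * G -> Prop) : Prop :=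
  (forall z, tame (fun g => A (z, g))) /\
  forall V, oG V -> borel oZ (fun z => meager oG (fun g => V g /\ A (z, g))).

(** By Baire category an open section is meager in [V] only if it misses [V], and meeting [V] is an
    open condition on [z]. *)
Lemma vaught_open (A : Z * G -> Prop) : prod_top oZ oG A -> vaught_measurable A.
Proof.
  intro HA.
  assert (Hsec : forall z, oG (fun g => A (z, g))).
  { intro z; apply (open_of_ball PG); intros g Hg.
    destruct (HA _ Hg) as [P [Q [_ [HQ [Hz [Hg' Hsub]]]]]].
    destruct (ball_of_open PG Q g HQ Hg') as [r [Hr HB]].
    exists r; split; [exact Hr|]; intros h Hh; apply Hsub; [exact Hz|apply HB, Hh]. }
  split; [intro z; apply tame_open, Hsec|].
  intros V HV.
  apply (borel_ext oZ (fun z => ~ exists g, V g /\ A (z, g))).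
  - apply borel_compl, borel_open, (open_of_ball PZ); intros z [g [Hg HAg]].
    destruct (HA _ HAg) as [P [Q [HP [_ [Hz [Hg' Hsub]]]]]].
    destruct (ball_of_open PZ P z HP Hz) as [r [Hr HB]].
    exists r; split; [exact Hr|]; intros y Hy; exists g; split; [exact Hg|].
    apply Hsub; [apply HB, Hy|exact Hg'].
  - intro z; split.
    + intro H; apply meager_empty; intros g Hg; apply H; exists g; exact Hg.
    + intros HM Hne; exact (baire oG PG _ (open_inter PG _ _ HV (Hsec z)) Hne HM).
Qed.

(** For complements, [tame_comeager] gives a countable combination of Borel conditions; a countable
    union is meager in [V] exactly when each member is. *)
Lemma vaught_sigma : sigma_algebra vaught_measurable.
Proof.
  pose proof (borel_sigma PZ) as HS.
  split.
  - apply vaught_open; intros [z g] _; exists (fun _ => True), (fun _ => True).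
    split; [apply (open_full PZ)|split; [apply (open_full PG)|auto]].
  - intros A [HA1 HA2]; split; [intro z; apply tame_compl, HA1|].
    intros V HV.
    apply (borel_ext oZ (fun z => forall n, (forall g, U n g -> V g) ->
      ~ meager oG (fun g => U n g /\ A (z, g)))).
    + apply (sa_inter HS (fun n z => (forall g, U n g -> V g) -> ~ meager oG (fun g => U n g /\ A (z, g)))).
      intro n; apply (sa_impl HS); intros _; apply borel_compl, HA2, U_open.
    + intro z; symmetry; exact (tame_comeager _ V (HA1 z) HV).
  - intros A HA; split; [intro z; apply (tame_union (fun n g => A n (z, g))); intro n; apply HA|].
    intros V HV.
    apply (borel_ext oZ (fun z => forall n, meager oG (fun g => V g /\ A n (z, g)))).
    + apply (sa_inter HS (fun n z => meager oG (fun g => V g /\ A n (z, g)))); intro n; apply HA, HV.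
    + intro z; split.
      * intro H; apply (meager_subset oG _ _ (meager_union oG _ H)); intros g [Hg [n Hn]]; exists n; auto.
      * intros H n; apply (meager_subset oG _ _ H); intros g [Hg1 Hg2]; split; [exact Hg1|exists n; exact Hg2].
  - intros A B [HA1 HA2] Hext; split.
    + intros z V HV; destruct (HA1 z V HV) as [H|[n [Hn H]]]; [left|right; exists n; split; [exact Hn|]];
        apply (meager_subset oG _ _ H); intros g [Hg1 Hg2]; split; auto; [|intro Hg; apply Hg2]; apply Hext; auto.
    + intros V HV; apply (borel_ext oZ _ _ (HA2 V HV)); intro z; split; intro H;
        apply (meager_subset oG _ _ H); intros g [Hg1 Hg2]; split; auto; apply Hext; auto.
Qed.

End Vaught.

(** * Generic values of the reduction *)

Section OrbitReduction.
Context {G X Y : Type} {oG : topology G} {oX : topology X} {oY : topology Y}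
  {dG : G -> G -> R} {dX : X -> X -> R} {dY : Y -> Y -> R}
  {eG : nat -> option G} {eX : nat -> option X} {eY : nat -> option Y}
  (PG : polish_metric oG dG eG) (PX : polish_metric oX dX eX) (PY : polish_metric oY dY eY)
  {mul : G -> G -> G} {inv : G -> G} {one : G} {act : G -> X -> X}
  (Gax : group_axioms mul inv one)
  (mul_cont : continuous (prod_top oG oG) oG (fun p => mul (fst p) (snd p)))
  (act_cont : continuous_action oG oX mul one act)
  (U : nat -> G -> Prop) (U_open : forall n, oG (U n)) (U_inh : forall n, exists x, U n x)
  (U_base : forall O x, oG O -> O x -> exists n, U n x /\ forall y, U n y -> O y)
  (F : Y -> Y -> Prop) (F_equiv : equivalence_rel F) (F_countable : forall y, countable_set (F y))
  (psi : X -> Y) (psi_borel : borel_map oX oY psi)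
  (psi_red : forall x y, orbit_eqrel act x y <-> F (psi x) (psi y)).

Let PXY := polish_metric_prod PX PY.

(** Pulled back from [F] along the reduction. *)
Lemma orbit_equivalence : equivalence_rel (orbit_eqrel act).
Proof.
  destruct F_equiv as [Fr [Fs Ft]]; split; [|split]; intros.
  - apply psi_red, Fr.
  - apply psi_red, Fs, psi_red; assumption.
  - apply psi_red, (Ft _ (psi y)); apply psi_red; assumption.
Qed.

Lemma right_translation_continuous (k : G) : continuous oG oG (fun g => mul g k).
Proof.
  intros O HO; apply (open_of_ball PG); intros g Hg.
  destruct (mul_cont O HO (g, k) Hg) as [A [B [HA [_ [Ha [Hb Hsub]]]]]].
  destruct (ball_of_open PG A _ HA Ha) as [r [Hr HB]].
  exists r; split; [exact Hr|]; intros h Hh; apply (Hsub (h, k)); [apply HB, Hh|exact Hb].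
Qed.

Lemma left_translation_continuous (k : G) : continuous oG oG (fun g => mul k g).
Proof.
  intros O HO; apply (open_of_ball PG); intros g Hg.
  destruct (mul_cont O HO (k, g) Hg) as [A [B [_ [HB [Ha [Hb Hsub]]]]]].
  destruct (ball_of_open PG B _ HB Hb) as [r [Hr H]].
  exists r; split; [exact Hr|]; intros h Hh; apply (Hsub (k, h)); [exact Ha|apply H, Hh].
Qed.

(** Right multiplication by [k] is a homeomorphism. It is needed because passing from [x] to
    [act k x] replaces [g] by [mul g k]. *)
Lemma meager_right_translate (M : G -> Prop) (k : G) :
  meager oG M -> meager oG (fun g => M (mul g k)).
Proof.
  destruct Gax as [Hassoc [_ [Hr [Hil Hir]]]].
  apply (meager_preimage oG (fun g => mul g k) (fun g => mul g (inv k))).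
  - apply right_translation_continuous.
  - apply right_translation_continuous.
  - intro g; rewrite <- Hassoc, Hil; apply Hr.
  - intro g; rewrite <- Hassoc, Hir; apply Hr.
Qed.

(** The map [p] covers two parameter spaces at once: [X] with the identity and [X * Y] with the
    first projection. *)
Lemma act_open {Z : Type} {oZ : topology Z} (p : Z -> X) : continuous oZ oX p ->
  forall O, oX O -> prod_top oZ oG (fun w => O (act (snd w) (p (fst w)))).
Proof.
  intros Hp O HO w Hw.
  destruct act_cont as [_ [_ Hc]].
  destruct (Hc O HO (snd w, p (fst w)) Hw) as [A [B [HA [HB [Ha [Hb Hsub]]]]]].
  exists (fun z => B (p z)), A.
  split; [exact (Hp B HB)|split; [exact HA|split; [exact Hb|split; [exact Ha|]]]].
  intros q H1 H2; apply (Hsub (snd q, p (fst q))); assumption.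
Qed.

Lemma proj_open {Z T : Type} {oZ : topology Z} {oT : topology T} (p : Z -> T) : continuous oZ oT p ->
  forall O, oT O -> prod_top oZ oG (fun w => O (p (fst w))).
Proof.
  intros Hp O HO w Hw; exists (fun z => O (p z)), (fun _ => True).
  split; [exact (Hp O HO)|split; [apply (open_full PG)|split; [exact Hw|auto]]].
Qed.

Lemma fst_continuous : continuous (prod_top oX oY) oX fst.
Proof.
  intros O HO w Hw; exists O, (fun _ => True).
  split; [exact HO|split; [apply (open_full PY)|auto]].
Qed.

Lemma snd_continuous : continuous (prod_top oX oY) oY snd.
Proof.
  intros O HO w Hw; exists (fun _ => True), O.
  split; [apply (open_full PX)|split; [exact HO|auto]].
Qed.

Lemma id_continuous : continuous oX oX (fun x => x).
Proof. intros O HO; exact HO. Qed.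

Lemma diagonal_borel : borel (prod_top oY oY) (fun q => fst q = snd q).
Proof.
  apply (borel_ext _ (fun q => ~ fst q <> snd q)); [|intro q; split; [apply NNPP|tauto]].
  apply borel_compl, borel_open; intros [a b] Hab; simpl in Hab.
  assert (Hpos : 0 < dY a b).
  { destruct (dist_nonneg PY a b) as [H|H]; [exact H|].
    destruct Hab; apply (dist_eq PY); auto. }
  exists (fun y => dY a y < dY a b / 2), (fun y => dY b y < dY a b / 2).
  split; [apply (open_ball PY)|split; [apply (open_ball PY)|]]; simpl.
  rewrite !(dist_refl PY); split; [lra|split; [lra|]].
  intros [a' b'] Ha Hb; simpl in *; intros ->.
  pose proof (dist_tri PY a b' b); rewrite (dist_sym PY b' b) in *; lra.
Qed.

Let VS := vaught_sigma PG U U_open U_inh U_base PXY.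
Let VSX := vaught_sigma PG U U_open U_inh U_base PX.

(** The set is the preimage of the diagonal of [Y] under a pair of maps, and the Borel map [psi] is
    handled by taking preimages of Borel sets under the action. *)
Lemma fiber_vaught : vaught_measurable (oG := oG) U (oZ := prod_top oX oY)
  (fun w => psi (act (snd w) (fst (fst w))) = snd (fst w)).
Proof.
  apply (sa_preimage_pair PY PY VS (fun w => psi (act (snd w) (fst (fst w)))) (fun w => snd (fst w)))
    with (C := fun q => fst q = snd q); [| |apply diagonal_borel].
  - intros O HO.
    apply (sa_preimage VS oX (fun w => act (snd w) (fst (fst w)))) with (B := fun x => O (psi x));
      [|apply psi_borel, borel_open, HO].
    intros O' HO'; apply (vaught_open PG U U_base PXY), (act_open fst fst_continuous), HO'.
  - intros O HO; apply (vaught_open PG U U_base PXY), (proj_open snd snd_continuous), HO.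
Qed.

Lemma translate_vaught (Q : X * Y -> Prop) : borel (prod_top oX oY) Q ->
  vaught_measurable (oG := oG) U (oZ := prod_top oX oY)
    (fun w => Q (act (snd w) (fst (fst w)), snd (fst w))).
Proof.
  apply (sa_preimage_pair PX PY VS (fun w => act (snd w) (fst (fst w))) (fun w => snd (fst w)));
    intros O HO; apply (vaught_open PG U U_base PXY).
  - apply (act_open fst fst_continuous), HO.
  - apply (proj_open snd snd_continuous), HO.
Qed.

Lemma graph_vaught (Q : X * Y -> Prop) : borel (prod_top oX oY) Q ->
  vaught_measurable (oG := oG) U (oZ := oX) (fun w => Q (fst w, psi (act (snd w) (fst w)))).
Proof.
  apply (sa_preimage_pair PX PY VSX (fun w => fst w) (fun w => psi (act (snd w) (fst w)))); intros O HO.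
  - apply (vaught_open PG U U_base PX), (proj_open (fun x => x) id_continuous), HO.
  - apply (sa_preimage VSX oX (fun w => act (snd w) (fst w))) with (B := fun x => O (psi x));
      [|apply psi_borel, borel_open, HO].
    intros O' HO'.
    apply (vaught_open PG U U_base PX), (act_open (fun x => x) id_continuous), HO'.
Qed.

Definition generic_value (m : nat) (z : X * Y) : Prop :=
  meager oG (fun g => U m g /\ psi (act g (fst z)) <> snd z).

Lemma generic_value_borel m : borel (prod_top oX oY) (generic_value m).
Proof. exact (proj2 (sa_compl _ VS _ fiber_vaught) (U m) (U_open m)). Qed.

Lemma generic_value_witness (m : nat) (O : G -> Prop) (x : X) (y : Y) :
  generic_value m (x, y) -> oG O -> (exists g, O g) -> (forall g, O g -> U m g) ->
  ~ meager oG (fun g => O g /\ psi (act g x) = y).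
Proof.
  intros Hy HO Hne Hsub HM; apply (baire oG PG O HO Hne).
  apply (meager_subset oG _ _ (meager_or oG _ _ Hy HM)); intros g Hg; simpl.
  destruct (classic (psi (act g x) = y)); auto.
Qed.

Lemma generic_value_attained m x y : generic_value m (x, y) -> exists g, psi (act g x) = y.
Proof.
  intro H; apply NNPP; intro Hno.
  apply (generic_value_witness m (U m) x y H (U_open m) (U_inh m)); [auto|].
  apply meager_empty; intros g [_ Hg]; apply Hno; exists g; exact Hg.
Qed.

(** Both orbits contain a point that [psi] sends to [y]. Thus fixing [y] leaves a single orbit to
    choose a point from. *)
Lemma generic_value_orbit m m' x x' y :
  generic_value m (x, y) -> generic_value m' (x', y) -> orbit_eqrel act x x'.
Proof.
  intros H H'; destruct orbit_equivalence as [Er [Es Et]].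
  destruct (generic_value_attained _ _ _ H) as [g Hg].
  destruct (generic_value_attained _ _ _ H') as [g' Hg'].
  apply (Et _ (act g x)); [exists g; reflexivity|].
  apply (Et _ (act g' x')); [|apply Es; exists g'; reflexivity].
  apply psi_red; rewrite Hg, Hg'; exact (proj1 F_equiv y).
Qed.

Lemma generic_value_class m x y : generic_value m (x, y) -> F (psi x) y.
Proof.
  intro H; destruct (generic_value_attained _ _ _ H) as [g <-].
  apply psi_red; exists g; reflexivity.
Qed.

(** For generic [u] in the overlap, the point [act (mul u k) x] has value [y] because [mul u k] lies
    in [U m], and value [y'] because [u] does. *)
Lemma generic_value_near m k x y y' :
  (exists u, U m u /\ U m (mul u k)) ->
  generic_value m (x, y) -> generic_value m (act k x, y') -> y = y'.
Proof.
  intros Hne H H'; apply NNPP; intro Hyy.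
  assert (HO : oG (fun u => U m u /\ U m (mul u k))).
  { apply (open_inter PG); [apply U_open|exact (right_translation_continuous k _ (U_open m))]. }
  apply (generic_value_witness m _ _ _ H' HO Hne); [tauto|].
  apply (meager_subset oG _ _ (meager_right_translate _ k H)).
  intros g [[Hg1 Hg2] Hg3]; split; [exact Hg2|simpl].
  destruct act_cont as [_ [Hm _]]; rewrite Hm, Hg3; auto.
Qed.

(** Countability of the [F]-class covers [G] by countably many fibers of [psi (act g x)]. One of
    them is nonmeager, hence by tameness comeager in some [U m]. *)
Lemma generic_value_exists x : exists m y, generic_value m (x, y).
Proof.
  destruct (F_countable (psi x)) as [f Hf].
  apply NNPP; intro Hno.
  apply (baire oG PG (fun _ => True) (open_full PG)); [exists one; exact I|].
  apply (meager_subset oG (fun g => exists n, exists y, f n = Some y /\ psi (act g x) = y)).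
  - apply (meager_union oG (fun n g => exists y, f n = Some y /\ psi (act g x) = y)); intro n.
    destruct (f n) as [y|]; [|apply meager_empty; intros g [y [Hy _]]; discriminate].
    destruct (proj1 fiber_vaught (x, y) (fun _ => True) (open_full PG)) as [HM|[m [_ HM]]].
    + apply (meager_subset oG _ _ HM); intros g [y' [Hy' Hg]]; injection Hy' as <-; auto.
    + destruct Hno; exists m, y; exact HM.
  - intros g _; destruct (Hf (psi (act g x))) as [n Hn].
    + apply psi_red; exists g; reflexivity.
    + exists n, (psi (act g x)); auto.
Qed.

(** The notion of largeness fed to [large_section_selection]: only the point moves, while the value
    in [Y] is held fixed. *)
Definition translate_nonmeager (z : X * Y) (Q : X * Y -> Prop) : Prop :=
  ~ meager oG (fun g => Q (act g (fst z), snd z)).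

(* Shrinking the open set on which the value is generic makes the set of translates keeping the value open around the identity. *)
Lemma generic_value_nonmeager x :
  exists m y, translate_nonmeager (x, y) (generic_value m).
Proof.
  destruct (generic_value_exists x) as [n [y Hy]].
  destruct Gax as [Hassoc [_ [Hr [Hil Hir]]]].
  destruct (U_inh n) as [v Hv].
  assert (Hv1 : U n (mul v one)) by (rewrite Hr; exact Hv).
  destruct (mul_cont (U n) (U_open n) (v, one) Hv1) as [A [W [HA [HW [Ha [Hw Hsub]]]]]].
  destruct (U_base A v HA Ha) as [m [_ HmA]].
  exists m, y; intro HM.
  apply (baire oG PG W HW); [exists one; exact Hw|].
  apply (meager_subset oG _ _ HM); intros k Hk.
  (* For [k] in [W], multiplication by [k] sends [U m] into [U n], so the exceptional set of
     [act k x] on [U m] lies in a translate of that of [x] on [U n]. *)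
  unfold generic_value; simpl.
  apply (meager_subset oG _ _ (meager_right_translate _ k Hy)).
  intros g [Hg1 Hg2]; split; [apply (Hsub (g, k)); auto|simpl].
  destruct act_cont as [_ [Hm _]]; rewrite Hm; exact Hg2.
Qed.

(** Translating [act k x] by [g] is translating [x] by [mul g k], and right translation preserves
    meagerness. *)
Lemma translate_nonmeager_orbit x x' y Q : orbit_eqrel act x x' ->
  (translate_nonmeager (x, y) Q <-> translate_nonmeager (x', y) Q).
Proof.
  assert (Himp : forall x x', orbit_eqrel act x x' ->
    translate_nonmeager (x', y) Q -> translate_nonmeager (x, y) Q).
  { intros a b [k <-] H HM; apply H; unfold translate_nonmeager in *; simpl in *.
    apply (meager_subset oG _ _ (meager_right_translate _ k HM)); intros g Hg.
    destruct act_cont as [_ [Hm _]]; rewrite Hm; exact Hg. }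
  destruct orbit_equivalence as [_ [Es _]].
  intro HE; split; apply Himp; [apply Es|]; exact HE.
Qed.

(** [T] consists of the large pairs fixed by the selector [s]. Two points of [T] with the same [y]
    share an orbit, so [s] agrees on them and they are equal. *)
Lemma generic_value_section m : exists T : X * Y -> Prop,
  borel (prod_top oX oY) T /\ (forall z, T z -> generic_value m z) /\
  (forall x x' y, T (x, y) -> T (x', y) -> x = x') /\
  (forall x y, translate_nonmeager (x, y) (generic_value m) ->
     exists p, T (p, y) /\ orbit_eqrel act x p).
Proof.
  destruct (large_section_selection PXY (generic_value m) translate_nonmeager)
    as [s [Hs1 [Hs2 Hs3]]].
  - apply generic_value_borel.
  - intros Q HQ; apply borel_compl.
    apply (borel_ext _ (fun z => meager oG (fun g => True /\ Q (act g (fst z), snd z)))).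
    + exact (proj2 (translate_vaught Q HQ) _ (open_full PG)).
    + intro z; split; intro H; apply (meager_subset oG _ _ H); tauto.
  - intros z Q Q' Hsub H HM; apply H; apply (meager_subset oG _ _ HM); intros g; apply Hsub.
  - intros z Q H; apply NNPP; intro Hno; apply H.
    apply (meager_union oG (fun n g => Q n (act g (fst z), snd z))); intro n.
    apply NNPP; intro Hn; apply Hno; exists n; exact Hn.
  - intros z Q H; apply NNPP; intro Hno; apply H; apply meager_empty.
    intros g Hg; apply Hno; eexists; exact Hg.
  - assert (Hclose : forall x y, translate_nonmeager (x, y) (generic_value m) ->
      exists p, s (x, y) = (p, y) /\ orbit_eqrel act x p).
    { intros x y Hz; destruct (Hs1 _ Hz) as [H1 H2].
      destruct (s (x, y)) as [p q] eqn:Hp.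
      (* All translates have second coordinate [y], and some of them come arbitrarily close to
         [s (x, y)]. *)
      assert (q = y) as ->.
      { apply (dist_small_eq PY); intros eps Heps.
        apply NNPP; intro Hno; apply (H2 eps Heps); apply meager_empty.
        intros g [_ Hg]; unfold sum_dist in Hg; simpl in Hg.
        pose proof (dist_nonneg PX p (act g x)); apply Hno; lra. }
      exists p; split; [reflexivity|].
      (* Some translate of [x] has [y] as a generic value, and so does [p]; hence they share an
         orbit. *)
      apply NNPP; intro Hno; apply Hz; apply meager_empty; intros g Hg; apply Hno; simpl in Hg.
      destruct orbit_equivalence as [_ [_ Et]].
      apply (Et _ (act g x)); [exists g; reflexivity|].
      exact (generic_value_orbit _ _ _ _ _ Hg H1). }
    exists (fun z => translate_nonmeager z (generic_value m) /\ s z = z).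
    split; [exact Hs3|split; [|split]].
    + intros z [Hz <-]; apply Hs1, Hz.
    + intros x x' y [H1 H2] [H1' H2'].
      assert (HE : orbit_eqrel act x x').
      { apply (generic_value_orbit m m x x' y); [rewrite <- H2|rewrite <- H2']; apply Hs1; assumption. }
      assert (Heq : s (x, y) = s (x', y)).
      { apply Hs2; [exact H1|]; intro Q; apply translate_nonmeager_orbit, HE. }
      rewrite H2, H2' in Heq; injection Heq; auto.
    + intros x y Hz; destruct (Hclose x y Hz) as [p [Hp HE]].
      exists p; split; [split|exact HE].
      * exact (proj1 (translate_nonmeager_orbit _ _ _ _ HE) Hz).
      (* The selector is constant along the orbit for fixed [y], so its value [(p, y)] is a fixed
         point. *)
      * rewrite <- Hp at 2; symmetry; apply Hs2; [exact Hz|].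
        intro Q; apply translate_nonmeager_orbit, HE.
Qed.

(** * The lacunary Borel sets *)

Lemma reducible_sigma_lacunary : sigma_lacunary oG oX one act.
Proof.
  destruct (functional_choice _ generic_value_section) as [T HT].
  (* This is the projection of [T m] to [X]. The missing coordinate is recovered as [psi (act g x)]
     for generic [g] in [U m], which makes the projection Borel. *)
  pose (B := fun m x => meager oG (fun g => U m g /\ ~ T m (x, psi (act g x)))).
  assert (HB : forall m x, B m x <-> exists y, T m (x, y)).
  { intros m x; split.
    - intro H; apply NNPP; intro Hno; apply (baire oG PG (U m) (U_open m) (U_inh m)).
      apply (meager_subset oG _ _ H); intros g Hg; split; [exact Hg|].
      intro HTg; apply Hno; eexists; exact HTg.
    - intros [y Hy]; pose proof (proj1 (proj2 (HT m)) _ Hy) as Hv.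
      apply (meager_subset oG _ _ Hv); intros g [Hg1 Hg2]; split; [exact Hg1|].
      simpl; intro Heq; apply Hg2; rewrite Heq; exact Hy. }
  destruct orbit_equivalence as [Er [Es Et]].
  (* The neighborhood is the set of quotients [mul (inv u) v] with [u] and [v] in [U m]. *)
  exists B, (fun m k => exists u, U m u /\ U m (mul u k)).
  split; [|split; [|split; [split|]]].
  - intro m; exact (proj2 (sa_compl _ VSX _ (graph_vaught _ (proj1 (HT m)))) (U m) (U_open m)).
  - intro m; split.
    + apply (open_union PG (fun u k => U m u /\ U m (mul u k))); intro u.
      destruct (classic (U m u)) as [Hu|Hu].
      * apply (open_ext PG _ _ (left_translation_continuous u _ (U_open m))); tauto.
      * apply (open_of_ball PG); tauto.
    + destruct (U_inh m) as [u Hu]; exists u; split; [exact Hu|].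
      rewrite (proj1 (proj2 (proj2 Gax))); exact Hu.
  - intro x; destruct (generic_value_nonmeager x) as [m [y Hy]].
    destruct (HT m) as [_ [_ [_ H]]]; destruct (H x y Hy) as [p [Hp HE]].
    exists p; split; [exists m; apply HB; exists y; exact Hp|exact HE].
  - intro x; destruct (F_countable (psi x)) as [f Hf].
    (* A point of the section in the orbit of [x] is determined by [m] and its generic value, which
       lies in the [F]-class enumerated by [f]; [k] codes [m] and the position in that
       enumeration. *)
    assert (Hsel : forall k : nat, exists o : option X, forall x' y,
      f (snd (of_nat k)) = Some y -> T (fst (of_nat k)) (x', y) -> o = Some x').
    { intro k; destruct (classic (exists x' y, f (snd (of_nat k)) = Some y /\ T (fst (of_nat k)) (x', y)))
        as [[x' [y [H1 H2]]]|Hno].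
      - exists (Some x'); intros x'' y' H3 H4; rewrite H1 in H3; injection H3 as <-.
        f_equal; destruct (HT (fst (of_nat k))) as [_ [_ [H _]]]; exact (H _ _ _ H2 H4).
      - exists None; intros x'' y' H3 H4; destruct Hno; exists x'', y'; auto. }
    destruct (functional_choice _ Hsel) as [h Hh]; exists h; intros x' [[m Hm] HE].
    apply HB in Hm; destruct Hm as [y Hy].
    pose proof (generic_value_class _ _ _ (proj1 (proj2 (HT m)) _ Hy)) as HF.
    destruct (Hf y) as [i Hi].
    { destruct F_equiv as [_ [_ Ft]]; apply (Ft _ (psi x')); [apply psi_red, HE|exact HF]. }
    exists (to_nat (m, i)); apply (Hh _ x' y); rewrite cancel_of_to; assumption.
  - intros m k x x' Hk Hx Hx' Heq; apply HB in Hx; apply HB in Hx'.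
    destruct Hx as [y Hy]; destruct Hx' as [y' Hy'].
    destruct (HT m) as [_ [Hv [Hinj _]]].
    assert (y = y') as <-.
    { subst x'; exact (generic_value_near m k x y y' Hk (Hv _ Hy) (Hv _ Hy')). }
    exact (Hinj _ _ _ Hy Hy').
Qed.

End OrbitReduction.

Theorem theorem1 (G X : Type) (oG : topology G) (oX : topology X)
  (mul : G -> G -> G) (inv : G -> G) (one : G) (act : G -> X -> X) :
  polish_group oG mul inv one ->
  polish oX ->
  continuous_action oG oX mul one act ->
  essentially_countable oX (orbit_eqrel act) ->
  sigma_lacunary oG oX one act.
Proof.
  intros [Gax [HG [Hmul _]]] HX Hact [Y [oY [F [HY [[Fe [_ Fc]] [[psi [Hpsi Hred]] _]]]]]].
  destruct (polish_has_metric oG HG) as [dG [eG PG]].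
  destruct (polish_has_metric oX HX) as [dX [eX PX]].
  destruct (polish_has_metric oY HY) as [dY [eY PY]].
  destruct (countable_nonempty_base PG one) as [U [HU1 [HU2 HU3]]].
  exact (reducible_sigma_lacunary PG PX PY Gax Hmul Hact U HU1 HU2 HU3 F Fe Fc psi Hpsi Hred).
Qed.
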